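(* Let $a$ be a parameter and let $T\in\{\mathrm{I},\mathrm{II}\}$. Suppose $(\alpha,\beta)$ is an A$_2$ Bailey pair of type $T$ relative to $a$. Define \[ \alpha'_k = a^{k_1+k_2}\, q^{\frac{1}{2}(k_1^2+k_2^2+k_3^2)}\,\alpha_k \qquad (k_1\ge k_2\ge k_3,\ k_1+k_2+k_3=0), \] \[ \beta'_L = f^{(T)}_L \sum_{r_1=0}^{L_1}\sum_{r_2=0}^{L_2} \frac{a^{r_1} q^{r_1^2-r_1r_2+r_2^2}}{(q)_{L_1-r_1}(q)_{L_2-r_2}}\,\beta_{r_1,r_2} \qquad (L_1,L_2\ge 0), \] where $f^{(\mathrm{I})}_L = 1/(aq)_{L_1+L_2}$ and $f^{(\mathrm{II})}_L=1$. Then $(\alpha',\beta')$ is an A$_2$ Bailey pair of type II relative to $a$.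
   Context: For any $x$ and integer $n$, $(x)_n=(x;q)_n=(x;q)_\infty/(xq^n;q)_\infty$, i.e. $(x)_n=\prod_{j=0}^{n-1}(1-xq^j)$ for $n\ge 0$ and $(x)_n=\prod_{j=1}^{-n}(1-xq^{-j})^{-1}$ for $n<0$; in particular $1/(q)_n=0$ for $n<0$. Write $\alpha_k=\alpha_{k_1,k_2,k_3}$ for integer triples $k$ with $k_1\ge k_2\ge k_3$, $k_1+k_2+k_3=0$, and $\beta_L=\beta_{L_1,L_2}$ for integers $L_1,L_2\ge 0$. A pair of sequences $(\alpha,\beta)$ is an A$_2$ Bailey pair of type I relative to $a$ if for all $L_1,L_2\ge0$ \[ \beta_L=\sum_{\substack{k_1\ge k_2\ge k_3\\ k_1+k_2+k_3=0}}\alpha_k\sum_r \frac{q^{r_1r_{23}}}{(q)_{r_1}(q)_{r_2}(aq)_{r_3}(q)_{r_{12}}(q)_{r_{13}}(q)_{r_{23}}}, \] where the inner sum is over integers $r_1,r_2,r_3,r_{12},r_{13},r_{23}$ satisfying $r_1+r_{12}+r_{13}=L_2-k_1$, $r_2+r_{12}+r_{23}=L_2-k_2$, $r_3+r_{13}+r_{23}=L_2-k_3$, $r_1+r_2+r_3=2L_1-L_2$, $r_{12}+r_{13}+r_{23}=2L_2-L_1$. It is an A$_2$ Bailey pair of type II relative to $a$ if for all $L_1,L_2\ge 0$ \[ \beta_L=\sum_{\substack{k_1\ge k_2\ge k_3\\ k_1+k_2+k_3=0}}\alpha_k\,\frac{(aq)_{L_1+L_2}}{(aq)_{L_1+k_1}(aq)_{L_1+k_2}(q)_{L_1+k_3}(q)_{L_2-k_1}(q)_{L_2-k_2}(aq)_{L_2-k_3}}.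 \] *)

(* Defs.v *)
From HB Require Import structures.
From mathcomp Require Import all_boot all_order all_algebra.
Set Implicit Arguments. Unset Strict Implicit. Unset Printing Implicit Defensive.
Import Order.TTheory GRing.Theory Num.Theory.
Local Open Scope ring_scope.

Section Defs.
Variable F : fieldType.

Definition poch (q x : F) (n : int) : F :=
  match n with
  | Posz m => \prod_(j < m) (1 - x * q ^+ j)
  | Negz m => \prod_(j < m.+1) (1 - x * q ^ (- (j.+1)%:Z))^-1
  end.

Definition zrange (N : nat) : seq int :=
  [seq (i%:Z - N%:Z) | i <- iota 0 (2 * N).+1].

(* Sum over all integer triples k = (k1,k2,k3) with k1 >= k2 >= k3 and
   k1 + k2 + k3 = 0 (k3 := -k1-k2), restricted to |k1|,|k2| <= N.
   For the sums below N is chosen so large that every omitted term vanishes. *)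
Definition ksum (N : nat) (G : int -> int -> int -> F) : F :=
  \sum_(k1 <- zrange N) \sum_(k2 <- zrange N | (k1 >= k2) && (k2 >= - k1 - k2))
     G k1 k2 (- k1 - k2).

Definition typeI_inner (q a : F) (L1 L2 : nat) (k1 k2 k3 : int) : F :=
  let M := (4 * (L1 + L2))%N in
  \sum_(r1 <- zrange M) \sum_(r2 <- zrange M) \sum_(r3 <- zrange M)
  \sum_(r12 <- zrange M) \sum_(r13 <- zrange M)
  \sum_(r23 <- zrange M |
      [&& r1 + r12 + r13 == L2%:Z - k1,
          r2 + r12 + r23 == L2%:Z - k2,
          r3 + r13 + r23 == L2%:Z - k3,
          r1 + r2 + r3 == 2 * L1%:Z - L2%:Z &
          r12 + r13 + r23 == 2 * L2%:Z - L1%:Z])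
    q ^ (r1 * r23) *
    ((poch q q r1)^-1 * (poch q q r2)^-1 * (poch q (a * q) r3)^-1 *
     (poch q q r12)^-1 * (poch q q r13)^-1 * (poch q q r23)^-1).

Definition bailey_pair_I (q a : F) (alpha : int -> int -> int -> F)
    (beta : nat -> nat -> F) : Prop :=
  forall L1 L2 : nat,
    beta L1 L2 =
    ksum (L1 + L2) (fun k1 k2 k3 => alpha k1 k2 k3 * typeI_inner q a L1 L2 k1 k2 k3).

Definition bailey_pair_II (q a : F) (alpha : int -> int -> int -> F)
    (beta : nat -> nat -> F) : Prop :=
  forall L1 L2 : nat,
    beta L1 L2 =
    ksum (L1 + L2) (fun k1 k2 k3 =>
      alpha k1 k2 k3 *
      (poch q (a * q) (L1%:Z + L2%:Z) *
       ((poch q (a * q) (L1%:Z + k1))^-1 * (poch q (a * q) (L1%:Z + k2))^-1 *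
        (poch q q (L1%:Z + k3))^-1 * (poch q q (L2%:Z - k1))^-1 *
        (poch q q (L2%:Z - k2))^-1 * (poch q (a * q) (L2%:Z - k3))^-1))).

Inductive btype := TypeI | TypeII.

Definition bailey_pair (T : btype) (q a : F) alpha beta : Prop :=
  match T with
  | TypeI => bailey_pair_I q a alpha beta
  | TypeII => bailey_pair_II q a alpha beta
  end.

Definition alpha' (q a : F) (alpha : int -> int -> int -> F) (k1 k2 k3 : int) : F :=
  a ^ (k1 + k2) * q ^ ((k1 ^+ 2 + k2 ^+ 2 + k3 ^+ 2) %/ 2)%Z * alpha k1 k2 k3.

Definition fT (T : btype) (q a : F) (L1 L2 : nat) : F :=
  match T with
  | TypeI => (poch q (a * q) (L1%:Z + L2%:Z))^-1
  | TypeII => 1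
  end.

Definition beta' (T : btype) (q a : F) (beta : nat -> nat -> F) (L1 L2 : nat) : F :=
  fT T q a L1 L2 *
  \sum_(r1 < L1.+1) \sum_(r2 < L2.+1)
    a ^+ r1 * q ^ ((r1%:Z) ^+ 2 - r1%:Z * r2%:Z + (r2%:Z) ^+ 2) *
    ((poch q q (L1%:Z - r1%:Z))^-1 * (poch q q (L2%:Z - r2%:Z))^-1) *
    beta r1 r2.

End Defs.

(* Main.v *)
Require Import Defs.
From HB Require Import structures.
From mathcomp Require Import all_boot all_order all_algebra.
From mathcomp Require Import ring zify.
Set Implicit Arguments.
Unset Strict Implicit.
Unset Printing Implicit Defensive.
Import Order.TTheory GRing.Theory Num.Theory.
Local Open Scope ring_scope.

(** Write e n = 1/(q)_n and f n = 1/(aq)_n for all integers n, so that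
    e vanishes at negative arguments. Since both sides are linear in alpha, the
    theorem amounts to one identity for each k, and every summation in it is an
    instance of q-Chu-Vandermonde.
    - Type II: q-Chu-Vandermonde read backwards expands the kernel at (r1, r2) as
      a sum over r; its exponent cancels the coupling q^(- r1 r2), and the r1- and
      r2-sums are then carried out separately.
    - Type I: the inner sum over r1 at fixed r12 is a q-Chu-Vandermonde sum; with
      r = L2 - r12 at (L1, L2), the L2-sum and then the L1-sum are two more.
    Both cases end with the same sum over r, evaluated by the variant
    [q_vandermonde_rev]. *)

(** * Finitely supported sums over lists of integers *)

Section FiniteSupport.
Variable V : nmodType.

(** Once zero terms are dropped, the two duplicate-free lists have the same members and so are
    permutations of each other. *)
Lemma eq_sum_supp (s1 s2 : seq int) (g : int -> V) :
    uniq s1 -> uniq s2 ->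
    (forall x, g x != 0 -> (x \in s1) && (x \in s2)) ->
  \sum_(x <- s1) g x = \sum_(x <- s2) g x.
Proof.
move=> u1 u2 sg.
have nz s : \sum_(x <- s) g x = \sum_(x <- [seq x <- s | g x != 0]) g x.
  rewrite big_filter [LHS](bigID (fun x => g x != 0)) /= [X in _ + X]big1 ?addr0 //.
  by move=> x; rewrite negbK => /eqP.
rewrite nz [RHS]nz; apply: perm_big; apply: uniq_perm; rewrite ?filter_uniq //.
by move=> x; rewrite !mem_filter; case: (boolP (g x != 0)) => //= /sg /andP[-> ->].
Qed.

Lemma big_ord_seqZ (n : nat) (h : int -> int) (g : int -> V) :
  \sum_(i < n) g (h i%:Z) = \sum_(x <- [seq h i%:Z | i <- iota 0 n]) g x.
Proof. by rewrite big_map -[n in iota 0 n]subn0 -/(index_iota 0 n) big_mkord. Qed.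

(** Meant for the type I sum, whose constraints fix four indices once two are given. The point must
    lie in the range only if its term is nonzero; otherwise all terms vanish. *)
Lemma sum4_point (s : seq int) (g : int -> int -> int -> int -> V) (c1 c2 c3 c4 : int) :
    uniq s ->
    (forall x y z t, g x y z t != 0 -> [/\ x = c1, y = c2, z = c3 & t = c4]) ->
    (g c1 c2 c3 c4 != 0 -> [/\ c1 \in s, c2 \in s, c3 \in s & c4 \in s]) ->
  \sum_(x <- s) \sum_(y <- s) \sum_(z <- s) \sum_(t <- s) g x y z t = g c1 c2 c3 c4.
Proof.
move=> us sg sc.
have [g0|gN0] := eqVneq (g c1 c2 c3 c4) 0.
  rewrite g0; do 4![apply: big1_seq => ? _]; apply/eqP/negPn/negP => gN0.
  by case: (sg _ _ _ _ gN0) => *; subst; rewrite g0 eqxx in gN0.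
have [s1 s2 s3 s4] := sc gN0.
have z x y z t : [|| x != c1, y != c2, z != c3 | t != c4] -> g x y z t = 0.
  move=> H; apply/eqP/negPn/negP => /sg [*]; subst.
  by rewrite !eqxx in H.
rewrite (bigD1_seq c1) //= [X in _ + X]big1 ?addr0; last first.
  by move=> x xN; do 3![apply: big1_seq => ? _]; rewrite z ?xN ?orbT.
rewrite (bigD1_seq c2) //= [X in _ + X]big1 ?addr0; last first.
  by move=> x xN; do 2![apply: big1_seq => ? _]; rewrite z ?xN ?orbT.
rewrite (bigD1_seq c3) //= [X in _ + X]big1 ?addr0; last first.
  by move=> x xN; apply: big1_seq => ? _; rewrite z ?xN ?orbT.
rewrite (bigD1_seq c4) //= [X in _ + X]big1 ?addr0 //.
by move=> x xN; rewrite z ?xN ?orbT.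
Qed.

End FiniteSupport.

Lemma mem_zrange (N : nat) (x : int) : (x \in zrange N) = (- N%:Z <= x <= N%:Z).
Proof.
apply/mapP/idP => [[i]|/andP[h1 h2]].
  by rewrite mem_iota => /andP[_ h] ->; lia.
by exists (absz (x + N%:Z)); rewrite ?mem_iota; lia.
Qed.

Lemma zrange_uniq (N : nat) : uniq (zrange N).
Proof. by rewrite map_inj_uniq ?iota_uniq // => i j /addIr []. Qed.

(** * Inverse q-Pochhammer symbols at integer index *)

Definition ipoch (F : fieldType) (q a : F) (n : int) : F := (poch q (a * q) n)^-1.

Section InversePochhammer.
Variables (F : fieldType) (q a : F).
Hypotheses (q0 : q != 0) (a_gen : forall n : nat, (0 < n)%N -> a * q ^+ n != 1).

Lemma ipochV (n : int) : 0 <= n -> poch q (a * q) n * ipoch q a n = 1.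
Proof.
case: n => // n _; rewrite divff //; apply/prodf_neq0 => j _.
by rewrite -mulrA -exprS subr_eq0 eq_sym a_gen.
Qed.

(** For positive [n] the factor 1 - a q^n is invertible by [a_gen]; for [n <= 0] it enters as a
    double inverse, which is the identity even at zero. *)
Lemma ipoch_pred (n : int) : ipoch q a (n - 1) = (1 - a * q ^ n) * ipoch q a n.
Proof.
case: n => [[|n]|n].
- rewrite sub0r /ipoch /= big_ord0 big_ord1 invrK invr1 mulr1.
  by rewrite expr0z -mulrA divff.
- have -> : n.+1%:Z - 1 = n by lia.
  have /= := @ipochV n.+1 isT; have /= := @ipochV n isT.
  rewrite /ipoch /= big_ord_recr /= => h1 h2.
  have -> : a * q ^ n.+1 = a * q * q ^+ n by rewrite -exprnP exprS mulrA.
  set x := 1 - _ in h2 *.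
  by rewrite invfM mulrCA divff ?mulr1 //; apply: contra_eq_neq h2 => ->;
    rewrite mulr0 mul0r eq_sym oner_eq0.
have -> : Negz n - 1 = Negz n.+1 by lia.
rewrite /ipoch /= big_ord_recr /= invfM invrK mulrC; congr (_ * _).
rewrite -mulrA; congr (1 - a * _).
by rewrite -{1}(expr1z q) -expfzDr //; congr (q ^ _); lia.
Qed.

Lemma ipoch0 : ipoch q a 0 = 1.
Proof. by rewrite /ipoch /= big_ord0 invr1. Qed.

Lemma ipochD (n : int) (B : nat) :
  ipoch q a n = ipoch q a (n + B) * \prod_(j < B) (1 - a * q ^ (n + 1 + j%:Z)).
Proof.
elim: B => [|B IH]; first by rewrite addr0 big_ord0 mulr1.
have -> : n + B.+1 = n + B + 1 by lia.
rewrite IH big_ord_recr /= -[in LHS](addrK 1 (n + B)) ipoch_pred.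
have -> : n + B + 1 = n + 1 + B by lia.
by ring.
Qed.

End InversePochhammer.

(** Genericity of q is [a_gen] at a = 1, so every result on f also applies to e. *)
Lemma q_gen1 (F : fieldType) (q : F) :
  (forall n : nat, (0 < n)%N -> q ^+ n != 1) ->
  forall n : nat, (0 < n)%N -> 1 * q ^+ n != 1.
Proof. by move=> hq n /hq; rewrite mul1r. Qed.

(** The factor j = 0 of the product is the inverse of 1 - q q^(-1) = 0. Since the inverse of 0 is 0,
    this realises the convention 1/(q)_n = 0. *)
Lemma ipoch1_lt0 (F : fieldType) (q : F) (n : int) : q != 0 -> n < 0 -> ipoch q 1 n = 0.
Proof.
case: n => // n q0 _; rewrite /ipoch /= big_ord_recl /= mul1r.
by rewrite divff // subrr invr0 mul0r invr0.
Qed.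

(** * Forms of the q-Chu-Vandermonde sum *)

Section Vandermonde.
Variables (F : fieldType) (q a : F).
Hypotheses (q0 : q != 0) (q_gen : forall n : nat, (0 < n)%N -> q ^+ n != 1).
Hypothesis (a_gen : forall n : nat, (0 < n)%N -> a * q ^+ n != 1).

Local Notation e := (ipoch q 1).
Local Notation f := (ipoch q a).

Lemma inv_qfact_pred (n : int) : e (n - 1) = (1 - q ^ n) * e n.
Proof. by rewrite ipoch_pred ?mul1r //; exact: q_gen1. Qed.

Lemma inv_qfact_lt0 n : n < 0 -> e n = 0. Proof. exact: ipoch1_lt0. Qed.
Arguments inv_qfact_lt0 : clear implicits.

(* All forms of q-Chu-Vandermonde below follow from [vsum_rec] by induction on A. *)
Definition vsum (A : nat) (C : int) (phi : int -> F) : F :=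
  \sum_(t < A.+1) q ^ (t%:Z * (t%:Z + C)) * e t * e (A%:Z - t%:Z) * phi t.

(** Split 1 - X Y = (1 - X) + X (1 - Y) with X = q^(A+1-t), Y = q^t. The first part lowers the
    argument of [e (A + 1 - t)], the second that of [e t], after which t is shifted by one. *)
Lemma vsum_rec A C phi :
  (1 - q ^ A.+1) * vsum A.+1 C phi =
  vsum A C phi + q ^ (A.+1%:Z + C) * vsum A (C + 1) (fun t => phi (t + 1)).
Proof.
transitivity (\sum_(t < A.+2) q ^ (t%:Z * (t%:Z + C)) * e t * e (A%:Z - t%:Z) * phi t
  + \sum_(t < A.+2) q ^ (t%:Z * (t%:Z + C) + (A.+1%:Z - t%:Z)) * e (t%:Z - 1) * e (A.+1%:Z - t%:Z) * phi t).
  rewrite -big_split /= mulr_sumr; apply: eq_bigr => t _.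
  have -> : A%:Z - t%:Z = A.+1%:Z - t%:Z - 1 by lia.
  rewrite !inv_qfact_pred (expfzDr (_ * _)) //.
  have -> : q ^ A.+1 = q ^ (A.+1%:Z - t%:Z) * q ^ t by rewrite -expfzDr // subrK.
  by ring.
(* The term t = A + 1 of the first sum and the term t = 0 of the second contain e(-1) = 0. *)
congr (_ + _).
  by rewrite big_ord_recr /= [X in _ + X](_ : _ = 0) ?addr0 // (inv_qfact_lt0 (_ - _)) ?mulr0 ?mul0r //; lia.
rewrite big_ord_recl (inv_qfact_lt0 (_ - 1)) ?mulr0 ?mul0r ?add0r; last by [].
rewrite mulr_sumr; apply: eq_bigr => t _; rewrite lift0.
have -> : t.+1%:Z = t%:Z + 1 :> int by lia.
rewrite addrK.
have -> : A.+1%:Z - (t%:Z + 1) = A%:Z - t%:Z by lia.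
have -> : (t%:Z + 1) * (t%:Z + 1 + C) + (A%:Z - t%:Z) = (A.+1%:Z + C) + t%:Z * (t%:Z + (C + 1)).
  have -> : A.+1%:Z = A%:Z + 1 by lia.
  by ring.
by rewrite expfzDr // !mulrA.
Qed.

Lemma subr_expq_neq0 A : 1 - q ^ A.+1 != 0.
Proof. by rewrite subr_eq0 eq_sym q_gen. Qed.

Lemma eq_vsum A C phi psi : (forall t : nat, phi t%:Z = psi t%:Z) -> vsum A C phi = vsum A C psi.
Proof. by move=> h; apply: eq_bigr => t _; rewrite h. Qed.

Lemma vsumZ A C phi c : vsum A C (fun t => c * phi t) = c * vsum A C phi.
Proof. by rewrite mulr_sumr; apply: eq_bigr => t _; rewrite mulrCA. Qed.

Lemma vsum0 C phi : vsum 0 C phi = phi 0.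
Proof. by rewrite /vsum big_ord1 mul0r expr0z subrr ipoch0 !mul1r. Qed.

(* The case B = oo of [vsum_vandermonde]. *)
Lemma vsum_limit A C : vsum A C (fun t => a ^ t * f (t + C)) = e A * f (A%:Z + C).
Proof.
elim: A C => [|A IH] C; first by rewrite vsum0 expr0z mul1r ipoch0 mul1r.
apply: (mulfI (subr_expq_neq0 A)); rewrite vsum_rec IH.
rewrite (@eq_vsum _ _ _ (fun t => a * (a ^ t * f (t + (C + 1))))); last first.
  by move=> t; rewrite -addrA (addrC 1 C) addrC mulrA [t%:Z + 1]addrC -exprSz.
rewrite vsumZ IH [in RHS]mulrA -inv_qfact_pred.
have -> : A.+1%:Z - 1 = A by lia.
have -> : A%:Z + (C + 1) = A.+1%:Z + C by lia.
have -> : A%:Z + C = A.+1%:Z + C - 1 by lia.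
(* With N = A + 1 + C this is (1 - a q^N) f(N) + a q^N f(N) = f(N). *)
by rewrite ipoch_pred //; ring.
Qed.


(* (aq)_(A+B+C) may have a pole at this generality; the product stands for
   (aq)_(A+B+C) / (aq)_(A+C). *)
Lemma vsum_vandermonde A (B : nat) C :
  vsum A C (fun t => a ^ t * f (t + C) * e (B%:Z - t)) =
  e A * e B * f (B%:Z + C) * \prod_(j < B) (1 - a * q ^ (A%:Z + C + 1 + j%:Z)).
Proof.
elim: A B C => [|A IH] B C.
  by rewrite vsum0 expr0z mul1r ipoch0 subr0 !add0r mul1r (ipochD q0 a_gen C B) (addrC C); ring.
apply: (mulfI (subr_expq_neq0 A)); rewrite vsum_rec IH !mulrA -inv_qfact_pred.
have -> : A.+1%:Z - 1 = A by lia.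
(* The shift lowers B by one; at B = 0 the shifted sum vanishes, its last factor having a negative
   argument. *)
case: B => [|B].
  rewrite [X in _ + _ * X]big1 ?mulr0 ?addr0 ?big_ord0 // => t _.
  by rewrite (inv_qfact_lt0 (_ - (_ + 1))) ?mulr0 //; lia.
rewrite (@eq_vsum _ _ _ (fun t => a * (a ^ t * f (t + (C + 1)) * e (B%:Z - t)))); last first.
  move=> t; rewrite -addrA (addrC 1 C) !mulrA [t%:Z + 1]addrC -exprSz.
  by congr (_ * _ * e _); lia.
rewrite vsumZ IH big_ord_recl /= big_ord_recr /= addr0.
have -> : e B = (1 - q ^ B.+1) * e B.+1 by rewrite -inv_qfact_pred; congr e; lia.
have -> : B%:Z + (C + 1) = B.+1%:Z + C by lia.
have -> : A%:Z + (C + 1) + 1 = A.+1%:Z + C + 1 by lia.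
have -> : A%:Z + C + 1 = A.+1%:Z + C by lia.
(* With X = q^(A+1+C), Y = q^(B+1), what remains is (1 - a X) + a X (1 - Y) = 1 - a X Y. *)
have -> : q ^ (A.+1%:Z + C + 1 + B) = q ^ (A.+1%:Z + C) * q ^ B.+1.
  by rewrite -expfzDr //; congr (q ^ _); lia.
under eq_bigr => j _ do rewrite /bump /= PoszD addrA.
by ring.
Qed.

(** The shift sends (B, C) to (B - 1, C + 1), which preserves the product. With X = q^(A+1+C), Y =
    q^B, the induction step is (1 - X) + X (1 - a Y) = 1 - a X Y. *)
Lemma vsum_vandermonde_rev A B C :
  vsum A C (fun t => e (t + C) * f (B - t)) =
  e A * e (A%:Z + C) * f B * \prod_(j < A) (1 - a * q ^ (B + C + 1 + j%:Z)).
Proof.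
elim: A B C => [|A IH] B C.
  by rewrite vsum0 ipoch0 subr0 !add0r mul1r big_ord0 mulr1.
apply: (mulfI (subr_expq_neq0 A)); rewrite vsum_rec IH !mulrA -inv_qfact_pred.
have -> : A.+1%:Z - 1 = A by lia.
rewrite (@eq_vsum _ _ _ (fun t => e (t + (C + 1)) * f (B - 1 - t))); last first.
  by move=> t; congr (e _ * f _); lia.
rewrite IH big_ord_recr /= ipoch_pred //.
have -> : B - 1 + (C + 1) = B + C by lia.
have -> : A%:Z + C = A.+1%:Z + C - 1 by lia.
have -> : A%:Z + (C + 1) = A.+1%:Z + C by lia.
have -> : q ^ (B + C + 1 + A) = q ^ (A.+1%:Z + C) * q ^ B.
  by rewrite -expfzDr //; congr (q ^ _); lia.
by rewrite inv_qfact_pred; ring.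
Qed.

(** [e t] and [e (A - t)] vanish unless 0 <= t <= A, so any list containing this interval gives the
    same sum. *)
Lemma sum_vsum (s : seq int) (A : nat) C phi :
    uniq s -> (forall t : int, 0 <= t -> t <= A -> t \in s) ->
  \sum_(t <- s) q ^ (t * (t + C)) * e t * e (A%:Z - t) * phi t = vsum A C phi.
Proof.
move=> us sA; rewrite /vsum.
rewrite (big_ord_seqZ A.+1 id (fun t => q ^ (t * (t + C)) * e t * e (A%:Z - t) * phi t)).
apply: eq_sum_supp => // [|x].
  by rewrite map_inj_uniq ?iota_uniq // => ? ? [].
have [x0|x0] := ltP x 0; first by rewrite inv_qfact_lt0 // mulr0 !mul0r eqxx.
have [Ax|Ax] := ltP A%:Z x; first by rewrite (inv_qfact_lt0 (_ - x)) ?mulr0 ?mul0r ?eqxx //; lia.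
move=> _; rewrite sA // andTb; apply/mapP; exists (absz x); rewrite ?mem_iota; lia.
Qed.

Lemma sum_vsum_lt0 (s : seq int) A C phi : A < 0 ->
  \sum_(t <- s) q ^ (t * (t + C)) * e t * e (A - t) * phi t = 0.
Proof.
move=> A0; apply: big1 => t _; have [t0|t0] := ltP t 0.
  by rewrite inv_qfact_lt0 // mulr0 !mul0r.
by rewrite (inv_qfact_lt0 (_ - t)) ?mulr0 ?mul0r //; lia.
Qed.

Lemma q_vandermonde_limit (s : seq int) A C :
    uniq s -> (forall t : int, 0 <= t -> t <= A -> t \in s) ->
  \sum_(t <- s) q ^ (t * (t + C)) * e t * e (A - t) * (a ^ t * f (t + C)) =
  e A * f (A + C).
Proof.
move=> us; case: (ltP A 0) => [A0 _|]; first by rewrite sum_vsum_lt0 // inv_qfact_lt0 // mul0r.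
by case: A => // A _ sA; rewrite sum_vsum // vsum_limit.
Qed.

(** For A + B + C >= 0 the symbol (aq)_(A+B+C) is invertible, and the product in [vsum_vandermonde]
    equals it times f(A + C). If A or B is negative, both sides vanish. *)
Lemma q_vandermonde (s : seq int) A B C :
    uniq s -> (forall t : int, 0 <= t -> t <= A -> t \in s) -> 0 <= A + B + C ->
  \sum_(t <- s) q ^ (t * (t + C)) * e t * e (A - t) * (a ^ t * f (t + C) * e (B - t)) =
  poch q (a * q) (A + B + C) * (e A * e B * f (A + C) * f (B + C)).
Proof.
move=> us; case: (ltP A 0) => [A0 _ _|]; first by rewrite sum_vsum_lt0 // inv_qfact_lt0 // !mul0r mulr0.
case: (ltP B 0) => [B0 A0 _ _|].
  rewrite (inv_qfact_lt0 _ B0) mulr0 !mul0r mulr0; apply: big1 => t _; have [t0|t0] := ltP t 0.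
    by rewrite inv_qfact_lt0 // mulr0 !mul0r.
  by rewrite (inv_qfact_lt0 (B - t)) ?mulr0 //; lia.
case: B A => // B [//|//] A _ _ sA D0; rewrite sum_vsum // vsum_vandermonde.
rewrite (ipochD q0 a_gen (A%:Z + C) B).
have -> : A%:Z + C + B = A%:Z + B + C by lia.
rewrite -[LHS]mul1r -(ipochV a_gen D0).
by ring.
Qed.

Lemma q_vandermonde_rev (s : seq int) A B C :
    uniq s -> (forall t : int, 0 <= t -> t <= A -> t \in s) -> 0 <= A + B + C ->
  \sum_(t <- s) q ^ (t * (t + C)) * e t * e (A - t) * (e (t + C) * f (B - t)) =
  poch q (a * q) (A + B + C) * (e A * e (A + C) * f B * f (B + C)).
Proof.
move=> us; case: (ltP A 0) => [A0 _ _|]; first by rewrite sum_vsum_lt0 // inv_qfact_lt0 // !mul0r mulr0.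
case: A => // A _ sA D0; rewrite sum_vsum // vsum_vandermonde_rev.
rewrite (ipochD q0 a_gen (B + C) A).
have -> : B + C + A = A%:Z + B + C by lia.
rewrite -[LHS]mul1r -(ipochV a_gen D0).
by ring.
Qed.

End Vandermonde.

(** * Weighted sums of the type II and type I kernels for one fixed k *)

Section Kernels.
Variables (F : fieldType) (q a : F).
Hypotheses (q0 : q != 0) (q_gen : forall n : nat, (0 < n)%N -> q ^+ n != 1).
Hypothesis (a_gen : forall n : nat, (0 < n)%N -> a * q ^+ n != 1).

Local Notation e := (ipoch q 1).
Local Notation f := (ipoch q a).

Lemma inv_qfactE (n : int) : (poch q q n)^-1 = e n.
Proof. by rewrite /ipoch mul1r. Qed.

Lemma qfactV (n : int) : 0 <= n -> poch q q n * e n = 1.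
Proof. by move=> n0; have := ipochV (q_gen1 q_gen) n0; rewrite mul1r. Qed.

Lemma uniq_shift (n : nat) (c : int) : uniq [seq i%:Z - c | i <- iota 0 n].
Proof. by rewrite map_inj_uniq ?iota_uniq // => i j /addIr []. Qed.

Lemma mem_shift (n : nat) (c t : int) : 0 <= t + c -> t + c < n ->
  t \in [seq i%:Z - c | i <- iota 0 n].
Proof. by move=> *; apply/mapP; exists (absz (t + c)); rewrite ?mem_iota; lia. Qed.

Lemma uniq_flip (n : nat) (c : int) : uniq [seq c - i%:Z | i <- iota 0 n].
Proof. by rewrite map_inj_uniq ?iota_uniq // => i j /addrI /oppr_inj []. Qed.

Lemma mem_flip (n : nat) (c t : int) : 0 <= c - t -> c - t < n ->
  t \in [seq c - i%:Z | i <- iota 0 n].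
Proof. by move=> *; apply/mapP; exists (absz (c - t)); rewrite ?mem_iota; lia. Qed.

Variables k1 k2 k3 : int.
Hypotheses (k21 : k2 <= k1) (k32 : k3 <= k2) (k3E : k3 = - k1 - k2).

Definition kernelII (L1 L2 : nat) : F :=
  poch q (a * q) (L1%:Z + L2%:Z) *
   (f (L1%:Z + k1) * f (L1%:Z + k2) * e (L1%:Z + k3) *
    e (L2%:Z - k1) * e (L2%:Z - k2) * f (L2%:Z - k3)).

Lemma kernelII_lt (L1 L2 : nat) : L2%:Z < k1 -> kernelII L1 L2 = 0.
Proof. by move=> h; rewrite /kernelII (@ipoch1_lt0 _ _ (_ - k1)) ?mulr0 ?mul0r ?mulr0 //; lia. Qed.

(** [q_vandermonde_rev] with t = r - k1, A = L2 - k1, B = L1 + k2, C = k1 - k2, so that A + B + C =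
    L1 + L2. *)
Lemma vandermonde_rev_sum (L1 L2 : nat) :
  \sum_(r < L2.+1) q ^ ((r%:Z - k1) * (r%:Z - k2)) *
    (e (r%:Z - k1) * e (r%:Z - k2) * e (L2%:Z - r%:Z) * f (L1%:Z - k3 - r%:Z)) =
  poch q (a * q) (L1%:Z + L2%:Z) *
    (f (L1%:Z + k1) * f (L1%:Z + k2) * e (L2%:Z - k1) * e (L2%:Z - k2)).
Proof.
transitivity (\sum_(t <- [seq i%:Z - k1 | i <- iota 0 L2.+1])
    q ^ (t * (t + (k1 - k2))) * e t * e (L2%:Z - k1 - t) *
    (e (t + (k1 - k2)) * f (L1%:Z + k2 - t))).
  rewrite -(big_ord_seqZ _ (fun r => r - k1) (fun t => q ^ (t * (t + (k1 - k2))) * e t *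
    e (L2%:Z - k1 - t) * (e (t + (k1 - k2)) * f (L1%:Z + k2 - t)))).
  apply: eq_bigr => r _.
  have -> : r%:Z - k1 + (k1 - k2) = r%:Z - k2 by lia.
  have -> : L2%:Z - k1 - (r%:Z - k1) = L2%:Z - r%:Z by lia.
  have -> : L1%:Z + k2 - (r%:Z - k1) = L1%:Z - k3 - r%:Z by lia.
  by ring.
rewrite q_vandermonde_rev ?uniq_shift //; last 2 first.
(* The range suffices because k1, the largest of three integers with sum 0, is nonnegative. *)
- by move=> t *; apply: mem_shift; lia.
- by lia.
have -> : L2%:Z - k1 + (L1%:Z + k2) + (k1 - k2) = L1%:Z + L2%:Z by lia.
have -> : L2%:Z - k1 + (k1 - k2) = L2%:Z - k2 by lia.
have -> : L1%:Z + k2 + (k1 - k2) = L1%:Z + k1 by lia.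
by ring.
Qed.

(* [q_vandermonde] read from right to left, with t = r2 - r. *)
Lemma kernelII_expand (n r1 r2 : nat) : (r2 <= n)%N ->
  kernelII r1 r2 = \sum_(r < n.+1)
    q ^ ((r2%:Z - r%:Z) * (r1%:Z - k3 - r%:Z)) * a ^ (r2%:Z - r%:Z) *
    (e (r2%:Z - r%:Z) * f (r1%:Z - k3 - r%:Z) * e (r%:Z - k1) * e (r%:Z - k2)) *
    (e (r1%:Z + k3) * f (r2%:Z - k3)).
Proof.
move=> r2n; rewrite -mulr_suml.
(* Here A = r2 - k1, B = r2 - k2, C = r1 - r2 - k3. The bound n is independent of r2, so that the
   sums can be exchanged later. *)
transitivity ((\sum_(t <- [seq r2%:Z - i%:Z | i <- iota 0 n.+1])
    q ^ (t * (t + (r1%:Z - r2%:Z - k3))) * e t * e (r2%:Z - k1 - t) *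
    (a ^ t * f (t + (r1%:Z - r2%:Z - k3)) * e (r2%:Z - k2 - t))) * (e (r1%:Z + k3) * f (r2%:Z - k3))).
  rewrite q_vandermonde ?uniq_flip //; last 2 first.
  - by move=> t *; apply: mem_flip; lia.
  - by lia.
  have -> : r2%:Z - k1 + (r2%:Z - k2) + (r1%:Z - r2%:Z - k3) = r1%:Z + r2%:Z by lia.
  have -> : r2%:Z - k1 + (r1%:Z - r2%:Z - k3) = r1%:Z + k2 by lia.
  have -> : r2%:Z - k2 + (r1%:Z - r2%:Z - k3) = r1%:Z + k1 by lia.
  by rewrite /kernelII; ring.
congr (_ * _); rewrite -(big_ord_seqZ _ (fun r => r2%:Z - r)
  (fun t => q ^ (t * (t + (r1%:Z - r2%:Z - k3))) * e t * e (r2%:Z - k1 - t) *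
    (a ^ t * f (t + (r1%:Z - r2%:Z - k3)) * e (r2%:Z - k2 - t)))).
apply: eq_bigr => r _.
have -> : r2%:Z - r%:Z + (r1%:Z - r2%:Z - k3) = r1%:Z - k3 - r%:Z by lia.
have -> : r2%:Z - k1 - (r2%:Z - r%:Z) = r%:Z - k1 by lia.
have -> : r2%:Z - k2 - (r2%:Z - r%:Z) = r%:Z - k2 by lia.
by ring.
Qed.

Lemma vandermonde_limit_sum (n : nat) (c C : int) : 0 <= c ->
  \sum_(r < n.+1) q ^ ((r%:Z - c) * (r%:Z - c + C)) *
     (e (r%:Z - c) * e (n%:Z - r%:Z) * (a ^ (r%:Z - c) * f (r%:Z - c + C))) =
  e (n%:Z - c) * f (n%:Z - c + C).
Proof.
move=> c0; rewrite -(@q_vandermonde_limit _ _ _ q0 q_gen a_gen [seq i%:Z - c | i <- iota 0 n.+1]); last 2 first.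
- exact: uniq_shift.
- by move=> t *; apply: mem_shift; lia.
rewrite -(big_ord_seqZ _ (fun r => r - c)
  (fun t => q ^ (t * (t + C)) * e t * e (n%:Z - c - t) * (a ^ t * f (t + C)))).
apply: eq_bigr => r _.
have -> : n%:Z - c - (r%:Z - c) = n%:Z - r%:Z by lia.
by ring.
Qed.

(** The ratio of alpha'_k to alpha_k: for k3 = - k1 - k2 the exponent of q is half the sum of the
    three squares. *)
Definition prefactor : F := a ^ (k1 + k2) * q ^ (k1 ^+ 2 + k1 * k2 + k2 ^+ 2).

(** As a may be 0, exponents are added only with equal signs; here k1 + k2 = - k3 >= 0. *)
Lemma expr_weight_split (r1 : nat) : 0 <= r1%:Z + k3 -> a ^+ r1 = a ^ (k1 + k2) * a ^ (r1%:Z + k3).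
Proof.
by move=> h; rewrite exprnP -exprzD_ss; [congr (a ^ _) | apply/orP; left]; lia.
Qed.

Lemma kernelII_sum (L1 L2 : nat) :
  \sum_(r1 < L1.+1) \sum_(r2 < L2.+1)
    a ^+ r1 * q ^ (r1%:Z ^+ 2 - r1%:Z * r2%:Z + r2%:Z ^+ 2) *
    (e (L1%:Z - r1%:Z) * e (L2%:Z - r2%:Z)) * kernelII r1 r2 =
  prefactor * kernelII L1 L2.
Proof.
(* At fixed r the summand factors into u, depending on r1, and v, depending on r2, both in the form
   summed by [vandermonde_limit_sum], with c = - k3 and c = r. *)
pose u (r : int) (r1 : nat) := q ^ ((r1%:Z - - k3) * (r1%:Z - - k3 + (- k3 - k3 - r))) *
  (e (r1%:Z - - k3) * e (L1%:Z - r1%:Z) * (a ^ (r1%:Z - - k3) * f (r1%:Z - - k3 + (- k3 - k3 - r)))).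
pose v (r : int) (r2 : nat) := q ^ ((r2%:Z - r) * (r2%:Z - r + (r - k3))) *
  (e (r2%:Z - r) * e (L2%:Z - r2%:Z) * (a ^ (r2%:Z - r) * f (r2%:Z - r + (r - k3)))).
transitivity (\sum_(r < L2.+1) prefactor * (q ^ ((r%:Z - k1) * (r%:Z - k2)) *
   (e (r%:Z - k1) * e (r%:Z - k2))) *
   ((\sum_(r1 < L1.+1) u r r1) * (\sum_(r2 < L2.+1) v r r2))).
  transitivity (\sum_(r < L2.+1) \sum_(r1 < L1.+1) \sum_(r2 < L2.+1)
    prefactor * (q ^ ((r%:Z - k1) * (r%:Z - k2)) *
      (e (r%:Z - k1) * e (r%:Z - k2))) * (u r r1 * v r r2)).
    rewrite [RHS]exchange_big /=; apply: eq_bigr => r1 _; rewrite [RHS]exchange_big /=.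
    apply: eq_bigr => r2 _; rewrite (@kernelII_expand L2) -1?ltnS // mulr_sumr.
    apply: eq_bigr => r _; rewrite /u /v.
    have -> : r1%:Z - - k3 = r1%:Z + k3 by lia.
    have [r1k|r1k] := ltP (r1%:Z + k3) 0; first by rewrite (ipoch1_lt0 q0 r1k); ring.
    rewrite (expr_weight_split r1k) /prefactor.
    have -> : r1%:Z + k3 + (- k3 - k3 - r%:Z) = r1%:Z - k3 - r%:Z by lia.
    have -> : r2%:Z - r%:Z + (r%:Z - k3) = r2%:Z - k3 by lia.
    have E : q ^ (r1%:Z ^+ 2 - r1%:Z * r2%:Z + r2%:Z ^+ 2) *
        q ^ ((r2%:Z - r%:Z) * (r1%:Z - k3 - r%:Z)) =
      q ^ (k1 ^+ 2 + k1 * k2 + k2 ^+ 2) * q ^ ((r%:Z - k1) * (r%:Z - k2)) *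
      q ^ ((r1%:Z + k3) * (r1%:Z - k3 - r%:Z)) * q ^ ((r2%:Z - r%:Z) * (r2%:Z - k3)).
      by rewrite -!expfzDr //; congr (q ^ _); rewrite k3E; ring.
    by ring: E.
  apply: eq_bigr => r _; rewrite big_distrlr mulr_sumr; apply: eq_bigr => r1 _.
  by rewrite mulr_sumr.
transitivity (prefactor * (e (L1%:Z + k3) * f (L2%:Z - k3)) *
  \sum_(r < L2.+1) q ^ ((r%:Z - k1) * (r%:Z - k2)) *
    (e (r%:Z - k1) * e (r%:Z - k2) * e (L2%:Z - r%:Z) * f (L1%:Z - k3 - r%:Z))).
  rewrite mulr_sumr; apply: eq_bigr => r _; rewrite /u /v !vandermonde_limit_sum //; last by lia.
  have -> : L1%:Z - - k3 = L1%:Z + k3 by lia.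
  have -> : L1%:Z + k3 + (- k3 - k3 - r%:Z) = L1%:Z - k3 - r%:Z by lia.
  have -> : L2%:Z - r%:Z + (r%:Z - k3) = L2%:Z - k3 by lia.
  by ring.
by rewrite vandermonde_rev_sum /kernelII; ring.
Qed.


(* The summation index r is l2 - r12. *)
Lemma typeI_innerE (n l1 l2 : nat) : (l2 <= n)%N ->
  typeI_inner q a l1 l2 k1 k2 k3 = \sum_(r < n.+1)
    poch q q (r%:Z + r%:Z + k3) * (e (r%:Z - k1) * e (r%:Z - k2)) *
    (f (l1%:Z - k3 - r%:Z) * e (l2%:Z - r%:Z) * e (r%:Z + k3 + l1%:Z - l2%:Z) *
     e (l2%:Z - l1%:Z + r%:Z)).
Proof.
move=> l2n; rewrite /typeI_inner; set M := (4 * _)%N.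
pose cond (r1 r2 r3 r12 r13 r23 : int) := [&& r1 + r12 + r13 == l2%:Z - k1,
  r2 + r12 + r23 == l2%:Z - k2, r3 + r13 + r23 == l2%:Z - k3,
  r1 + r2 + r3 == 2 * l1%:Z - l2%:Z & r12 + r13 + r23 == 2 * l2%:Z - l1%:Z].
pose T (r1 r2 r3 r12 r13 r23 : int) := if cond r1 r2 r3 r12 r13 r23 then
  q ^ (r1 * r23) * (e r1 * e r2 * f r3 * e r12 * e r13 * e r23) else 0.
(* The sum over r12 goes outermost, as it is the one that survives. *)
transitivity (\sum_(r12 <- zrange M) \sum_(r1 <- zrange M) \sum_(r2 <- zrange M)
    \sum_(r3 <- zrange M) \sum_(r13 <- zrange M) \sum_(r23 <- zrange M) T r1 r2 r3 r12 r13 r23).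
  rewrite [RHS]exchange_big; apply: eq_bigr => r1 _.
  rewrite [RHS]exchange_big; apply: eq_bigr => r2 _.
  rewrite [RHS]exchange_big; apply: eq_bigr => r3 _.
  do 2!apply: eq_bigr => ? _; rewrite big_mkcond; apply: eq_bigr => ? _.
  by rewrite !inv_qfactE.
pose g (r12 : int) := poch q q (l2%:Z - r12 + (l2%:Z - r12) + k3) *
  (e (l2%:Z - r12 - k1) * e (l2%:Z - r12 - k2)) *
  (f (l1%:Z - k3 - (l2%:Z - r12)) * e (l2%:Z - (l2%:Z - r12)) *
   e (l2%:Z - r12 + k3 + l1%:Z - l2%:Z) * e (l2%:Z - l1%:Z + (l2%:Z - r12))).
transitivity (\sum_(r12 <- zrange M) g r12); last first.
  transitivity (\sum_(r < n.+1) g (l2%:Z - r%:Z)).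
    rewrite (big_ord_seqZ n.+1 (fun r => l2%:Z - r)).
    apply: eq_sum_supp; rewrite ?zrange_uniq ?uniq_flip // => x gx.
    have x0 : 0 <= x.
      rewrite leNgt; apply: contraNN gx => h.
      by rewrite /g (@ipoch1_lt0 _ q (l2%:Z - (l2%:Z - x))) //; [apply/eqP; ring | lia].
    have x1 : 0 <= l2%:Z - x - k1.
      rewrite leNgt; apply: contraNN gx => h.
      by rewrite /g (@ipoch1_lt0 _ q (l2%:Z - x - k1)) //; apply/eqP; ring.
    by rewrite mem_zrange mem_flip; lia.
  by apply: eq_bigr => r _; rewrite /g; have -> : l2%:Z - (l2%:Z - r%:Z) = r%:Z by lia.
apply: eq_bigr => r12 _.
have zT (r1 r2 r3 r13 r23 : int) : [|| r1 < 0, r2 < 0, r12 < 0, r13 < 0 | r23 < 0] ->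
    q ^ (r1 * r23) * (e r1 * e r2 * f r3 * e r12 * e r13 * e r23) = 0.
  by case/or4P => [h|h|h|/orP[h|h]]; rewrite (ipoch1_lt0 q0 h); ring.
(* The five constraints have rank four; these are their solutions in terms of r1 and r12. *)
pose r13 (r1 : int) : int := l2%:Z - k1 - r12 - r1.
pose r23 (r1 : int) : int := r1 + (l2%:Z - l1%:Z + k1).
pose r2 (r1 : int) : int := l1%:Z + k3 - r12 - r1.
pose r3 : int := l1%:Z - l2%:Z - k3 + r12.
transitivity (\sum_(r1 <- zrange M)
    q ^ (r1 * r23 r1) * (e r1 * e (r2 r1) * f r3 * e r12 * e (r13 r1) * e (r23 r1))).
  apply: eq_bigr => r1 _.
  rewrite (@sum4_point _ _ _ (r2 r1) r3 (r13 r1) (r23 r1)) ?zrange_uniq //.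
  - rewrite /T ifT // /cond /r2 /r3 /r13 /r23; apply/and5P; split; apply/eqP; lia.
  - move=> x y z t; rewrite /T; case: ifP => [|_]; last by rewrite eqxx.
    move=> /and5P[/eqP ? /eqP ? /eqP ? /eqP ? /eqP ?] _.
    by rewrite /r2 /r3 /r13 /r23; split; lia.
  rewrite /T; case: ifP => [_ h|_]; last by rewrite eqxx.
  (* In a nonzero term all indices except possibly r3 are nonnegative, and the constraints then keep
     them all within M. *)
  have : ~~ [|| r1 < 0, r2 r1 < 0, r12 < 0, r13 r1 < 0 | r23 r1 < 0].
    by apply: contraNN h => h; rewrite zT.
  by rewrite !mem_zrange /M /r2 /r3 /r13 /r23; split; lia.
have [r12N|r12P] := ltP r12 0.
  rewrite big1 => [|r1 _]; last by rewrite zT // r12N !orbT.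
  by rewrite /g (@ipoch1_lt0 _ q (l2%:Z - (l2%:Z - r12))) //; [ring | lia].
(* This number is A + B + C in the sum below and equals r1 + r2 + r13 + r23. If it is negative, so
   is one of these indices, and every term vanishes. *)
have [NN|NP] := ltP (l2%:Z - r12 + (l2%:Z - r12) + k3) 0.
  rewrite big1 => [|r1 _]; last by rewrite zT // /r2 /r13 /r23; lia.
  by rewrite /g (@ipoch1_lt0 _ q (l2%:Z - r12 - k1)) //; [ring | lia].
transitivity ((e r12 * f r3) * \sum_(t <- zrange M) q ^ (t * (t + (l2%:Z - l1%:Z + k1))) *
    e t * e (l2%:Z - k1 - r12 - t) *
    (1 ^ t * e (t + (l2%:Z - l1%:Z + k1)) * e (l1%:Z + k3 - r12 - t))).
  rewrite mulr_sumr; apply: eq_bigr => r1 _; rewrite exp1rz /r2 /r13 /r23.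
  by ring.
rewrite (q_vandermonde q0 q_gen (q_gen1 q_gen)) ?zrange_uniq ?mul1r //; last 2 first.
- by move=> t *; rewrite mem_zrange /M; lia.
- by lia.
rewrite /g /r3.
have -> : l2%:Z - k1 - r12 + (l1%:Z + k3 - r12) + (l2%:Z - l1%:Z + k1) =
  l2%:Z - r12 + (l2%:Z - r12) + k3 by lia.
have -> : l2%:Z - k1 - r12 = l2%:Z - r12 - k1 by lia.
have -> : l2%:Z - r12 - k1 + (l2%:Z - l1%:Z + k1) = l2%:Z - l1%:Z + (l2%:Z - r12) by lia.
have -> : l1%:Z + k3 - r12 + (l2%:Z - l1%:Z + k1) = l2%:Z - r12 - k2 by lia.
have -> : l1%:Z - k3 - (l2%:Z - r12) = l1%:Z - l2%:Z - k3 + r12 by lia.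
have -> : l2%:Z - (l2%:Z - r12) = r12 by lia.
have -> : l2%:Z - r12 + k3 + l1%:Z - l2%:Z = l1%:Z + k3 - r12 by lia.
by ring.
Qed.

Lemma typeI_inner_lt (l1 l2 : nat) : l2%:Z < k1 -> typeI_inner q a l1 l2 k1 k2 k3 = 0.
Proof.
move=> h; rewrite (@typeI_innerE l2) //; apply: big1 => r _.
have rl : (r <= l2)%N by rewrite -ltnS.
by rewrite (@ipoch1_lt0 _ q (r%:Z - k1)) //; [ring | lia].
Qed.

(** [q_vandermonde] with t = r - c. The base b is 1 for the l2-sum and a for the l1-sum of type
    I. *)
Lemma vandermonde_sum (b : F) (n : nat) (c B C : int) :
    (forall m : nat, (0 < m)%N -> b * q ^+ m != 1) ->
    0 <= c -> 0 <= n%:Z - c + B + C ->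
  \sum_(r < n.+1) q ^ ((r%:Z - c) * (r%:Z - c + C)) *
     (e (r%:Z - c) * e (n%:Z - r%:Z) *
      (b ^ (r%:Z - c) * ipoch q b (r%:Z - c + C) * e (B + c - r%:Z))) =
  poch q (b * q) (n%:Z - c + B + C) *
    (e (n%:Z - c) * e B * ipoch q b (n%:Z - c + C) * ipoch q b (B + C)).
Proof.
move=> b_gen c0 D0; rewrite -(@q_vandermonde _ _ _ q0 q_gen b_gen [seq i%:Z - c | i <- iota 0 n.+1]) //; last 2 first.
- exact: uniq_shift.
- by move=> t *; apply: mem_shift; lia.
rewrite -(big_ord_seqZ _ (fun r => r - c) (fun t => q ^ (t * (t + C)) * e t *
  e (n%:Z - c - t) * (b ^ t * ipoch q b (t + C) * e (B - t)))).
apply: eq_bigr => r _.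
have -> : n%:Z - c - (r%:Z - c) = n%:Z - r%:Z by lia.
have -> : B - (r%:Z - c) = B + c - r%:Z by lia.
by ring.
Qed.

Lemma typeI_sum (L1 L2 : nat) :
  \sum_(l1 < L1.+1) \sum_(l2 < L2.+1)
    a ^+ l1 * q ^ (l1%:Z ^+ 2 - l1%:Z * l2%:Z + l2%:Z ^+ 2) *
    (e (L1%:Z - l1%:Z) * e (L2%:Z - l2%:Z)) * typeI_inner q a l1 l2 k1 k2 k3 =
  poch q (a * q) (L1%:Z + L2%:Z) * (prefactor * kernelII L1 L2).
Proof.
transitivity (prefactor * poch q (a * q) (L1%:Z + L2%:Z) * (e (L1%:Z + k3) * f (L2%:Z - k3)) *
  \sum_(r < L2.+1) q ^ ((r%:Z - k1) * (r%:Z - k2)) *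
    (e (r%:Z - k1) * e (r%:Z - k2) * e (L2%:Z - r%:Z) * f (L1%:Z - k3 - r%:Z))); last first.
  by rewrite vandermonde_rev_sum /kernelII; ring.
rewrite mulr_sumr.
transitivity (\sum_(r < L2.+1) \sum_(l1 < L1.+1) \sum_(l2 < L2.+1)
  a ^+ l1 * q ^ (l1%:Z ^+ 2 - l1%:Z * l2%:Z + l2%:Z ^+ 2) *
    (e (L1%:Z - l1%:Z) * e (L2%:Z - l2%:Z)) *
    (poch q q (r%:Z + r%:Z + k3) * (e (r%:Z - k1) * e (r%:Z - k2)) *
    (f (l1%:Z - k3 - r%:Z) * e (l2%:Z - r%:Z) * e (r%:Z + k3 + l1%:Z - l2%:Z) *
     e (l2%:Z - l1%:Z + r%:Z)))).
  rewrite [RHS]exchange_big; apply: eq_bigr => l1 _; rewrite [RHS]exchange_big.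
  by apply: eq_bigr => l2 _; rewrite (@typeI_innerE L2) -1?ltnS // mulr_sumr.
apply: eq_bigr => r _; have rL : (r <= L2)%N by rewrite -ltnS.
(* Both sides contain e(r - k1), which vanishes for r < k1. For r >= k1 one has 2 r + k3 >= k1 - k2
   >= 0, as [P1] and [P2] require. *)
have [rk|rk] := ltP r%:Z k1.
  rewrite (@ipoch1_lt0 _ q (r%:Z - k1)) ?subr_lt0 // !mul0r !mulr0.
  by do 2![apply: big1 => ? _]; ring.
(* The numerator (q)_(L2+r+k3) of the l2-sum. It is free of l1, so it leaves the l1-sum, whose value
   contains e(L2 + r + k3) and cancels it. *)
pose P := poch q q (L2%:Z - r%:Z + (r%:Z + k3) + r%:Z).
have P1 : P * e (L2%:Z - r%:Z + (r%:Z + k3) + r%:Z) = 1.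
  by apply: qfactV; lia.
have P2 : poch q q (r%:Z + r%:Z + k3) * e (r%:Z + r%:Z + k3) = 1.
  by apply: qfactV; lia.
transitivity (\sum_(l1 < L1.+1) (prefactor * (q ^ ((r%:Z - k1) * (r%:Z - k2)) *
    (e (r%:Z - k1) * e (r%:Z - k2) * e (L2%:Z - r%:Z)) * P)) *
  (q ^ ((l1%:Z - - k3) * (l1%:Z - - k3 + (- k3 - k3 - r%:Z))) *
   (e (l1%:Z - - k3) * e (L1%:Z - l1%:Z) * (a ^ (l1%:Z - - k3) *
      f (l1%:Z - - k3 + (- k3 - k3 - r%:Z)) * e (L2%:Z + r%:Z + k3 + - k3 - l1%:Z))))).
  apply: eq_bigr => l1 _.
  transitivity ((a ^+ l1 * q ^ (l1%:Z ^+ 2 + r%:Z ^+ 2 - r%:Z * l1%:Z) * e (L1%:Z - l1%:Z) *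
     (poch q q (r%:Z + r%:Z + k3) * (e (r%:Z - k1) * e (r%:Z - k2)) * f (l1%:Z - k3 - r%:Z))) *
    (\sum_(l2 < L2.+1) q ^ ((l2%:Z - r%:Z) * (l2%:Z - r%:Z + (r%:Z + r%:Z - l1%:Z))) *
      (e (l2%:Z - r%:Z) * e (L2%:Z - l2%:Z) *
       (1 ^ (l2%:Z - r%:Z) * e (l2%:Z - r%:Z + (r%:Z + r%:Z - l1%:Z)) *
        e (l1%:Z + k3 + r%:Z - l2%:Z))))).
    rewrite mulr_sumr; apply: eq_bigr => l2 _; rewrite exp1rz.
    have -> : l2%:Z - r%:Z + (r%:Z + r%:Z - l1%:Z) = l2%:Z - l1%:Z + r%:Z by lia.
    have -> : r%:Z + k3 + l1%:Z - l2%:Z = l1%:Z + k3 + r%:Z - l2%:Z by lia.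
    have E : q ^ (l1%:Z ^+ 2 - l1%:Z * l2%:Z + l2%:Z ^+ 2) =
      q ^ (l1%:Z ^+ 2 + r%:Z ^+ 2 - r%:Z * l1%:Z) *
      q ^ ((l2%:Z - r%:Z) * (l2%:Z - l1%:Z + r%:Z)).
      by rewrite -expfzDr //; congr (q ^ _); ring.
    by rewrite E; ring.
  rewrite (vandermonde_sum (q_gen1 q_gen)) //; last by lia.
  rewrite mul1r.
  have -> : l1%:Z - - k3 = l1%:Z + k3 by lia.
  have [l1k|l1k] := ltP (l1%:Z + k3) 0; first by rewrite (ipoch1_lt0 q0 l1k); ring.
  rewrite (expr_weight_split l1k) /prefactor.
  have -> : L2%:Z - r%:Z + (l1%:Z + k3) + (r%:Z + r%:Z - l1%:Z) = L2%:Z - r%:Z + (r%:Z + k3) + r%:Z by lia.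
  have -> : L2%:Z - r%:Z + (r%:Z + r%:Z - l1%:Z) = L2%:Z + r%:Z - l1%:Z by lia.
  have -> : l1%:Z + k3 + (r%:Z + r%:Z - l1%:Z) = r%:Z + r%:Z + k3 by lia.
  have -> : l1%:Z + k3 + (- k3 - k3 - r%:Z) = l1%:Z - k3 - r%:Z by lia.
  have -> : L2%:Z + r%:Z + k3 + - k3 - l1%:Z = L2%:Z + r%:Z - l1%:Z by lia.
  rewrite -/P.
  have E : q ^ (l1%:Z ^+ 2 + r%:Z ^+ 2 - r%:Z * l1%:Z) =
      q ^ (k1 ^+ 2 + k1 * k2 + k2 ^+ 2) * q ^ ((r%:Z - k1) * (r%:Z - k2)) *
      q ^ ((l1%:Z + k3) * (l1%:Z - k3 - r%:Z)).
    by rewrite -!expfzDr //; congr (q ^ _); rewrite k3E; ring.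
  (* [P2] cancels (q)_(2r+k3) from the inner type I sum against e(2r + k3) from the l2-sum. *)
  by ring: E P2.
rewrite -mulr_sumr vandermonde_sum //; [|lia|lia].
have -> : L1%:Z - - k3 + (L2%:Z + r%:Z + k3) + (- k3 - k3 - r%:Z) = L1%:Z + L2%:Z by lia.
have -> : L1%:Z - - k3 + (- k3 - k3 - r%:Z) = L1%:Z - k3 - r%:Z by lia.
have -> : L2%:Z + r%:Z + k3 + (- k3 - k3 - r%:Z) = L2%:Z - k3 by lia.
have -> : L2%:Z + r%:Z + k3 = L2%:Z - r%:Z + (r%:Z + k3) + r%:Z by lia.
have -> : L1%:Z - - k3 = L1%:Z + k3 by lia.
by ring: P1.
Qed.

End Kernels.

(** * Truncated sums over k, and reduction of the theorem to the kernels *)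

Lemma ksum_widen (F : fieldType) (n N : nat) (G : int -> int -> int -> F) : (n <= N)%N ->
    (forall k1 k2 : int, n%:Z < k1 -> k2 <= k1 -> - k1 - k2 <= k2 -> G k1 k2 (- k1 - k2) = 0) ->
  ksum n G = ksum N G.
Proof.
move=> nN G0; rewrite /ksum.
under eq_bigr do rewrite big_mkcond; under [RHS]eq_bigr do rewrite big_mkcond.
(* The order conditions force k1 >= 0 and |k2| <= k1, so only the bound on k1 matters. *)
have inner k1 : k1 <= n%:Z ->
  \sum_(k2 <- zrange n) (if (k2 <= k1) && (- k1 - k2 <= k2) then G k1 k2 (- k1 - k2) else 0) =
  \sum_(k2 <- zrange N) (if (k2 <= k1) && (- k1 - k2 <= k2) then G k1 k2 (- k1 - k2) else 0).
  move=> k1n; apply: eq_sum_supp; rewrite ?zrange_uniq // => k2.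
  by case: ifP => [|_]; rewrite ?eqxx // !mem_zrange; lia.
transitivity (\sum_(k1 <- zrange n)
  \sum_(k2 <- zrange N) (if (k2 <= k1) && (- k1 - k2 <= k2) then G k1 k2 (- k1 - k2) else 0)).
  by apply: eq_big_seq => k1; rewrite mem_zrange => k1n; apply: inner; lia.
apply: eq_sum_supp; rewrite ?zrange_uniq // => k1; rewrite !mem_zrange => sum_neq0.
have [/andP[h0 hn]|h] := boolP (0 <= k1 <= n%:Z); first by lia.
case/eqP: sum_neq0; apply: big1 => k2 _; case: ifP => // /andP[h1 h2].
by apply: G0 => //; lia.
Qed.

Lemma eq_ksum (F : fieldType) (N : nat) (G H : int -> int -> int -> F) :
    (forall k1 k2 k3 : int, k2 <= k1 -> k3 <= k2 -> k3 = - k1 - k2 -> G k1 k2 k3 = H k1 k2 k3) ->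
  ksum N G = ksum N H.
Proof.
move=> GH; apply: eq_bigr => k1 _; apply: eq_bigr => k2 /andP[h1 h2].
exact: GH.
Qed.

Lemma ksum_sum (F : fieldType) (N n : nat) (c : 'I_n -> F) (G : 'I_n -> int -> int -> int -> F) :
  \sum_(i < n) c i * ksum N (G i) = ksum N (fun k1 k2 k3 => \sum_(i < n) c i * G i k1 k2 k3).
Proof.
rewrite /ksum; under eq_bigr do rewrite mulr_sumr.
rewrite exchange_big; apply: eq_bigr => k1 _.
under eq_bigr do rewrite mulr_sumr.
by rewrite exchange_big.
Qed.

Lemma mul_ksum (F : fieldType) (N : nat) (c : F) (G : int -> int -> int -> F) :
  c * ksum N G = ksum N (fun k1 k2 k3 => c * G k1 k2 k3).
Proof. by rewrite mulr_sumr; apply: eq_bigr => k1 _; rewrite mulr_sumr. Qed.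

Lemma alpha'E (F : fieldType) (q a : F) alpha (k1 k2 k3 : int) : k3 = - k1 - k2 ->
  alpha' q a alpha k1 k2 k3 = prefactor q a k1 k2 * alpha k1 k2 k3.
Proof.
move=> k3E; rewrite /alpha' /prefactor; congr (_ * q ^ _ * _).
have -> : k1 ^+ 2 + k2 ^+ 2 + k3 ^+ 2 = (k1 ^+ 2 + k1 * k2 + k2 ^+ 2) * 2.
  by rewrite k3E; ring.
by rewrite mulzK.
Qed.

(** All beta_(l1,l2) are first widened to the common range L1 + L2, which allows the sum over k to
    be taken outside. K stands for the kernel of either type. *)
Lemma beta'_ksum (F : fieldType) (q a : F) (T : btype) alpha beta
    (K : nat -> nat -> int -> int -> int -> F) (L1 L2 : nat) :
    (forall (l1 l2 : nat) (k1 k2 : int), l2%:Z < k1 -> k2 <= k1 -> - k1 - k2 <= k2 ->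
       K l1 l2 k1 k2 (- k1 - k2) = 0) ->
    (forall l1 l2 : nat, beta l1 l2 =
       ksum (l1 + l2) (fun k1 k2 k3 => alpha k1 k2 k3 * K l1 l2 k1 k2 k3)) ->
  beta' T q a beta L1 L2 = ksum (L1 + L2) (fun k1 k2 k3 => alpha k1 k2 k3 *
    (fT T q a L1 L2 * \sum_(l1 < L1.+1) \sum_(l2 < L2.+1)
      a ^+ l1 * q ^ (l1%:Z ^+ 2 - l1%:Z * l2%:Z + l2%:Z ^+ 2) *
      (ipoch q 1 (L1%:Z - l1%:Z) * ipoch q 1 (L2%:Z - l2%:Z)) * K l1 l2 k1 k2 k3)).
Proof.
move=> K0 betaE; rewrite /beta'.
transitivity (fT T q a L1 L2 * \sum_(l1 < L1.+1) 1 * ksum (L1 + L2) (fun k1 k2 k3 =>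
  \sum_(l2 < L2.+1) a ^+ l1 * q ^ (l1%:Z ^+ 2 - l1%:Z * l2%:Z + l2%:Z ^+ 2) *
      (ipoch q 1 (L1%:Z - l1%:Z) * ipoch q 1 (L2%:Z - l2%:Z)) * (alpha k1 k2 k3 * K l1 l2 k1 k2 k3))).
  congr (_ * _); apply: eq_bigr => l1 _; rewrite mul1r -ksum_sum; apply: eq_bigr => l2 _.
  rewrite betaE !inv_qfactE; congr (_ * _); apply: ksum_widen.
    by rewrite leq_add // -ltnS.
  by move=> k1 k2 h1 h2 h3; rewrite K0 ?mulr0 //; lia.
rewrite ksum_sum mul_ksum; apply: eq_ksum => k1 k2 k3 _ _ _.
rewrite mulrCA; congr (_ * _); rewrite mulr_sumr; apply: eq_bigr => l1 _.
rewrite mul1r mulr_sumr; apply: eq_bigr => l2 _.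
by rewrite mulrCA.
Qed.

Theorem theorem4p3 (F : fieldType) (q a : F)
    (hq0 : q != 0)
    (hq : forall n : nat, (0 < n)%N -> q ^+ n != 1)
    (ha : forall n : nat, (0 < n)%N -> a * q ^+ n != 1)
    (T : btype) (alpha : int -> int -> int -> F) (beta : nat -> nat -> F) :
  bailey_pair T q a alpha beta ->
  bailey_pair_II q a (alpha' q a alpha) (beta' T q a beta).
Proof.
have toII L1 L2 : ksum (L1 + L2) (fun k1 k2 k3 =>
    alpha' q a alpha k1 k2 k3 * kernelII q a k1 k2 k3 L1 L2) =
  ksum (L1 + L2) (fun k1 k2 k3 =>
    alpha k1 k2 k3 * (prefactor q a k1 k2 * kernelII q a k1 k2 k3 L1 L2)).
  by apply: eq_ksum => k1 k2 k3 _ _ k3E; rewrite alpha'E //; ring.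
have kII L1 L2 k1 k2 k3 : poch q (a * q) (L1%:Z + L2%:Z) *
       ((poch q (a * q) (L1%:Z + k1))^-1 * (poch q (a * q) (L1%:Z + k2))^-1 *
        (poch q q (L1%:Z + k3))^-1 * (poch q q (L2%:Z - k1))^-1 *
        (poch q q (L2%:Z - k2))^-1 * (poch q (a * q) (L2%:Z - k3))^-1) =
   kernelII q a k1 k2 k3 L1 L2 by rewrite !inv_qfactE.
case: T => pair L1 L2.
- rewrite (@beta'_ksum _ _ _ _ alpha _ (typeI_inner q a)) //; last first.
    by move=> l1 l2 k1 k2 *; apply: typeI_inner_lt.
  transitivity (ksum (L1 + L2) (fun k1 k2 k3 =>
    alpha k1 k2 k3 * (prefactor q a k1 k2 * kernelII q a k1 k2 k3 L1 L2))).
    apply: eq_ksum => k1 k2 k3 h1 h2 h3; rewrite typeI_sum // /fT.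
    (* The factor (aq)_(L1+L2) produced by [typeI_sum] cancels against f^(I). *)
    have := ipochV ha (isT : 0 <= L1%:Z + L2%:Z); rewrite /ipoch => pochV.
    by congr (_ * _); ring: pochV.
  by rewrite -toII; apply: eq_ksum => *; rewrite kII.
- rewrite (@beta'_ksum _ _ _ _ alpha _ (fun l1 l2 k1 k2 k3 => kernelII q a k1 k2 k3 l1 l2)).
  + transitivity (ksum (L1 + L2) (fun k1 k2 k3 =>
      alpha k1 k2 k3 * (prefactor q a k1 k2 * kernelII q a k1 k2 k3 L1 L2))).
      by apply: eq_ksum => k1 k2 k3 h1 h2 h3; rewrite kernelII_sum //= mul1r.
    by rewrite -toII; apply: eq_ksum => *; rewrite kII.
  + by move=> l1 l2 k1 k2 *; apply: kernelII_lt.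
  + by move=> l1 l2; rewrite pair; apply: eq_ksum => *; rewrite kII.
Qed.
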